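(* Let $\mathcal{S}=\{\emptyset,\{4,5,6\},\{1,3,4\},\{1,2,5,6\},\{1,2,3,4\}\}\subset\mathcal{P}([6])$. Then $\mathcal{S}$ is a counterexample to the following conjecture: ''If $n\ge3$ and $\mathcal{S}$ is a family of sets with $U(\mathcal{S})=[n]$ that is a minimal generator for a union-closed family $\mathcal{F}$ which is a Non-FC-family, then $\mathcal{S}$ is regular.'' That is: $U(\mathcal{S})=[6]$, $\mathcal{S}$ is a minimal generator of $\langle\mathcal{S}\rangle$, $\langle\mathcal{S}\rangle$ is a Non-FC-family, and $\mathcal{S}$ is not regular.
   Context: A UC (union-closed) family is a nonempty finite family $\mathcal{F}$ of distinct finite sets such that $A\cup B\in\mathcal{F}$ for all $A,B\in\mathcal{F}$. $[n]=\{1,\dots,n\}$, $\mathcal{P}([n])$ is its power set, $U(\mathcal{F})$ is the union of all sets in $\mathcal{F}$, and $\mathcal{F}_i=\{F\in\mathcal{F} : i\in F\}$. A UC family $\mathcal{A}$, whose largest set is $U(\mathcal{A})$, is an FC-family iff for every UC family $\mathcal{F}\supseteq\mathcal{A}$ there is $i\in U(\mathcal{A})$ with $|\mathcal{F}_i|\ge|\mathcal{F}|/2$; it is a Non-FC-family iff there is a UC family $\mathcal{F}\supseteq\mathcal{A}$ such that $|\mathcal{F}_i|<|\mathcal{F}|/2$ for every $i\in U(\mathcal{A})$. For a family of sets $\mathcal{S}$, $\langle\mathcal{S}\rangle$ is the UC family generated by $\mathcal{S}$, i.e. the smallest (under inclusion) UC family containing $\mathcal{S}$; $\mathcal{S}$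 is a generator of $\mathcal{F}$ if $\langle\mathcal{S}\rangle=\mathcal{F}$, and it is a minimal generator if it does not properly contain another generator of $\mathcal{F}$. Regular: let $\mathcal{S}$ be a family with $U(\mathcal{S})=[n]$ that is a minimal generator for a UC family $\mathcal{F}$ which is a Non-FC-family. Then $\mathcal{S}$ is regular iff for every $A\in\mathcal{S}$ with $A\ne\emptyset$ and every $i\in[n]$, the UC family $\langle(\mathcal{S}\setminus\{A\})\cup\{A\cup\{i\}\}\rangle$ is Non-FC. *)

(* Defs.v *)
From mathcomp Require Import all_boot finmap.
From mathcomp Require Import boolp classical_sets.

Set Implicit Arguments.
Unset Strict Implicit.
Unset Printing Implicit Defensive.

Local Open Scope fset_scope.

(* The elements of the finite sets range over
   nat: any finite family of finite sets can be relabelled so as to live there,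
   so the size of the ambient ground set is not restricted. *)
Definition set_family := {fset {fset nat}}.

Implicit Types (A B : {fset nat}) (F G S T : set_family).

Definition interval1 (n : nat) : {fset nat} := [fset i in iota 1 n].

Definition union_closed F : Prop :=
  F != fset0 /\ (forall A B, A \in F -> B \in F -> A `|` B \in F).

Definition union_of F : {fset nat} := \bigcup_(A <- F) A.

Definition star F (i : nat) : set_family := [fset A in F | i \in A].

(* |G_i| < |G| / 2 is written 2 |G_i| < |G|. *)
Definition non_FC F : Prop :=
  union_closed F /\
  exists G, [/\ union_closed G, F `<=` G &
    forall i, i \in union_of F -> 2 * #|` star G i| < #|` G| ].

Definition smallest_union_closed S F : Prop :=
  [/\ union_closed F, S `<=` F &
    forall G, union_closed G -> S `<=` G -> F `<=` G].

(* The smallest union-closed family containing S; it exists as soon as S is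
   nonempty (uc_genP below), and the default value is the empty family. *)
Definition uc_gen S : set_family :=
  xget fset0 [set F | smallest_union_closed S F]%classic.

Definition generator S F : Prop := uc_gen S = F.

Definition minimal_generator S F : Prop :=
  generator S F /\ (forall T, T `<` S -> ~ generator T F).

(* Meaningful when union_of S = interval1 n and S is a minimal generator of a
   Non-FC family. *)
Definition regular (n : nat) S : Prop :=
  forall A, A \in S -> A != fset0 ->
  forall i, i \in interval1 n -> non_FC (uc_gen ((S `\ A) `|` [fset A `|` [fset i]])).

Lemma smallest_union_closed_uniq S F G :
  smallest_union_closed S F -> smallest_union_closed S G -> F = G.
Proof.
move=> [ucF SF minF] [ucG SG minG]; apply/eqP; rewrite eqEfsubset.
by rewrite minF // minG.
Qed.

Lemma union_ofU F G : union_of (F `|` G) = union_of F `|` union_of G.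
Proof.
apply/fsetP => x; rewrite in_fsetU; apply/bigfcupP/orP.
  move=> [A]; rewrite andbT in_fsetU => /orP[AF|AG] xA.
    by left; apply/bigfcupP; exists A; rewrite ?AF.
  by right; apply/bigfcupP; exists A; rewrite ?AG.
by case=> /bigfcupP[A /andP[AF _] xA]; exists A; rewrite // in_fsetU AF ?orbT.
Qed.

Lemma union_of1 A : union_of [fset A] = A.
Proof. by rewrite /union_of big_seq_fset1. Qed.

Lemma union_of_in F T :
  union_closed F -> T `<=` F -> T != fset0 -> union_of T \in F.
Proof.
move=> [_ ucF]; elim/finSet_rect: T => T IH TF /fset0Pn[A AT].
have AF : A \in F by exact: (fsubsetP TF).
have := fsetD1K AT; have [->|T0] := eqVneq (T `\ A) fset0.
  by rewrite fsetU0 => <-; rewrite union_of1.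
move=> <-; rewrite union_ofU union_of1; apply: ucF => //; apply: IH => //.
  exact: fproperD1.
exact: fsubset_trans (fsubD1set _ _) TF.
Qed.

Lemma uc_genP S : S != fset0 -> smallest_union_closed S (uc_gen S).
Proof.
move=> S0; rewrite /uc_gen.
pose F := [fset union_of T | T in fpowerset S `\ fset0]%fset.
have FP A : A \in F <-> exists2 T, (T `<=` S) && (T != fset0) & A = union_of T.
  split=> [/imfsetP[T /=]|[T /andP[TS T0] ->]].
    by rewrite !inE fpowersetE => /andP[T0 TS] ->; exists T; rewrite ?TS.
  by apply/imfsetP; exists T; rewrite //= !inE T0 fpowersetE.
have SF : S `<=` F.
  apply/fsubsetP => A AS; apply/FP; exists [fset A]; last by rewrite union_of1.
  by rewrite fsub1set AS /=; apply/fset0Pn; exists A; rewrite inE.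
apply: (@xgetPex _ fset0 [set F | smallest_union_closed S F]%classic).
exists F; split=> //; first split.
- by case/fset0Pn: S0 => A AS; apply/fset0Pn; exists A; apply: (fsubsetP SF).
- move=> A B /FP[T /andP[TS T0] ->] /FP[T' /andP[TS' T0'] ->].
  rewrite -union_ofU; apply/FP; exists (T `|` T') => //.
  rewrite fsubUset TS TS' /=; case/fset0Pn: T0 => C CT.
  by apply/fset0Pn; exists C; rewrite in_fsetU CT.
- move=> G ucG SG; apply/fsubsetP => A /FP[T /andP[TS T0] ->].
  by apply: union_of_in => //; exact: fsubset_trans TS SG.
Qed.

(* Main.v *)
(* Let S' be S with {1,2,3,4} replaced by {1,2,3,4,5}. The family <S'> is FC by
   a weight argument: with the weights 16, 8, 12, 20, 17, 15 on 1, ..., 6, every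
   union-closed family B of subsets of [6] stable under union with the members
   of S' satisfies sum_i c_i (2 |B_i| - |B|) >= 0, which a branch-and-bound
   search establishes. Any union-closed G containing S' splits, according to the
   traces outside [6], into such families, so |G_i| < |G| / 2 cannot hold for all
   i in [6].

   For <S>, no such weights exist. For k in [6] let B_k be the family of the
   sets B such that k \in B implies k \in A and A subset of B for some A in <S>.
   A weighted sum of the excesses 2 |(B_k)_i| - |B_k| is negative in every
   coordinate i. Following Poonen, take N new elements, and let G consist of
   <S>, of the sets B u X where X is the set of all new elements, and of the
   sets B u (X \ {x_j}) with B in B_(k_j), where the list k_1, ..., k_N repeats
   each k proportionally to its coefficient. Distinct X \ {x_j} have union X, so
   G is union-closed; for large N the negative excesses outweigh that of <S>. *)

Require Import Defs.
From mathcomp Require Import all_boot finmap.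
From Stdlib Require Import ZArith.
From mathcomp Require Import ssralg zify ssrZ.

Set Implicit Arguments.
Unset Strict Implicit.
Unset Printing Implicit Defensive.

Local Open Scope fset_scope.

Implicit Types (p q h : seq bool) (F G S T : set_family) (Y : {fset nat}).

(** * Subsets of [n] as sequences of booleans *)

Fixpoint cube n : seq (seq bool) :=
  if n is n'.+1 then map (cons false) (cube n') ++ map (cons true) (cube n')
  else [:: [::]].

Lemma mem_cube n p : (p \in cube n) = (size p == n).
Proof.
elim: n p => [|n IH] [|b p] //=; rewrite mem_cat.
  by apply/negbTE; rewrite negb_or; apply/andP; split; apply/mapP => -[].
have inj c : injective (cons c : seq bool -> _) by move=> x y [].
have out c d s : c != d -> (c :: p \in map (cons d) s) = false.
  by move=> cd; apply/negP => /mapP[x _ [/eqP]]; rewrite (negbTE cd).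
by case: b; rewrite mem_map // out // IH eqSS ?orbF.
Qed.

Lemma cube_uniq n : uniq (cube n).
Proof.
elim: n => //= n IH; rewrite cat_uniq !map_inj_uniq ?IH => [|x y []|x y []] //.
rewrite andbT; apply/hasPn => _ /mapP[x _ ->].
by apply/negP => /mapP[].
Qed.

Definition por p q : seq bool := [seq x.1 || x.2 | x <- zip p q].

Lemma size_por n p q : size p = n -> size q = n -> size (por p q) = n.
Proof. by move=> sp sq; rewrite size_map size1_zip sp // sq. Qed.

Lemma nth_por p q i : size p = size q ->
  nth false (por p q) i = nth false p i || nth false q i.
Proof.
move=> spq; case: (ltnP i (size p)) => ip; last first.
  by rewrite [in LHS]nth_default ?(size_por (n := size p)) // !nth_default // -spq.
by rewrite (nth_map (false, false)) ?nth_zip //= size1_zip // spq.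
Qed.

(** Position [j] of [p], counted from 0, stands for the element [j + 1]; hence the [.-1] wherever an
    element is looked up in a path. *)
Definition pset p : {fset nat} := [fset i in mask p (iota 1 (size p))].

Lemma in_pset p i : (i \in pset p) = (0 < i) && nth false p i.-1.
Proof.
rewrite inE /= in_mask ?iota_uniq // mem_iota add1n ltnS.
case: i => //= i; case: (ltnP i (size p)) => ip; last by rewrite [RHS]nth_default.
congr nth; rewrite -[i.+1]add1n -(nth_iota 0 1 ip).
by rewrite index_uniq ?size_iota ?iota_uniq.
Qed.

Lemma psetU p q : size p = size q -> pset (por p q) = pset p `|` pset q.
Proof.
move=> spq; apply/fsetP => i.
by rewrite in_fsetU !in_pset nth_por // andb_orr.
Qed.

Definition path_of n (A : {fset nat}) : seq bool := [seq i \in A | i <- iota 1 n].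

Lemma size_path_of n A : size (path_of n A) = n.
Proof. by rewrite size_map size_iota. Qed.

Lemma nth_path_of n A i : i < n -> nth false (path_of n A) i = (i.+1 \in A).
Proof. by move=> ltin; rewrite (nth_map 0) ?size_iota // nth_iota. Qed.

Lemma pset_path_of n A : pset (path_of n A) = A `&` interval1 n.
Proof.
apply/fsetP => i; rewrite in_pset !inE mem_iota add1n ltnS.
case: i => [|i] /=; first by rewrite andbF.
case: ltnP => ltin; first by rewrite andbT nth_path_of.
by rewrite andbF nth_default ?size_path_of.
Qed.

Lemma path_of_pset n p Y : size p = n -> [disjoint Y & interval1 n] ->
  path_of n (pset p `|` Y) = p.
Proof.
move=> sp /fdisjointP dY.
apply: (@eq_from_nth _ false); rewrite size_path_of // => i ltin.
rewrite nth_path_of // in_fsetU in_pset /=.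
case: (boolP (i.+1 \in Y)) => [/dY|]; last by rewrite orbF.
by rewrite inE /= mem_iota add1n !ltnS ltin.
Qed.

Lemma psetUD n p Y : size p = n -> [disjoint Y & interval1 n] ->
  (pset p `|` Y) `\` interval1 n = Y.
Proof.
move=> sp /fdisjointP dY; apply/fsetP => i.
rewrite in_fsetD in_fsetU in_pset inE /= mem_iota add1n.
case: (boolP (i \in Y)) => [/dY|_].
  by rewrite inE /= mem_iota add1n => ->; rewrite orbT.
rewrite orbF; case: i => [|i] //=; rewrite ltnS; case: ltnP => //= ni.
by rewrite nth_default ?sp.
Qed.

Definition pfam (L : seq (seq bool)) : set_family := [fset A in map pset L].

Lemma pfamP L A : reflect (exists2 p, p \in L & A = pset p) (A \in pfam L).
Proof. by rewrite inE; apply: mapP. Qed.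

Lemma pset_inj n : {in [pred p | size p == n] &, injective pset}.
Proof.
move=> p q /eqP sp /eqP sq E.
by rewrite -(path_of_pset sp (fdisjoint0X _)) E (path_of_pset sq (fdisjoint0X _)).
Qed.

Definition por_closed (L : seq (seq bool)) : bool :=
  all (fun p => all (fun q => por p q \in L) L) L.

Definition uniform n (L : seq (seq bool)) : bool := all (fun p => size p == n) L.

Lemma union_closed_pfam n L :
  L != [::] -> uniform n L -> por_closed L -> union_closed (pfam L).
Proof.
move=> L0 /allP uL /allP cL; split.
  case: L L0 {uL cL} => // p L _; apply/fset0Pn; exists (pset p).
  by apply/pfamP; exists p; rewrite ?mem_head.
move=> A B /pfamP[p pL ->] /pfamP[q qL ->]; apply/pfamP; exists (por p q).
  by have /allP := cL _ pL; apply.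
by rewrite psetU // (eqP (uL _ pL)) (eqP (uL _ qL)).
Qed.

(** * Branch and bound over union-closed families *)

(** Sets of paths stored by shared prefixes. [Leaf false] is the empty set at every depth. *)
Inductive trie := Leaf of bool | Node of trie & trie.

Fixpoint tmem t p : bool :=
  match t, p with
  | Leaf b, [::] => b
  | Node l r, b :: p => tmem (if b then r else l) p
  | _, _ => false
  end.

Definition tleft t := if t is Node l _ then l else Leaf false.
Definition tright t := if t is Node _ r then r else Leaf false.

Fixpoint tunion t u :=
  match t, u with
  | Leaf false, _ => u
  | Node l r, Node l' r' => Node (tunion l l') (tunion r r')
  | _, _ => t
  end.

Fixpoint tsingle p : trie :=
  if p is b :: p then
    if b then Node (Leaf false) (tsingle p) else Node (tsingle p) (Leaf false)
  else Leaf true.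

Definition trie_of (L : seq (seq bool)) : trie :=
  foldr (fun p => tunion (tsingle p)) (Leaf false) L.

Fixpoint tjoin h t : trie :=
  match h, t with
  | [::], Leaf b => t
  | b :: h, Node l r =>
    if b then Node (Leaf false) (tjoin h (tunion l r)) else Node (tjoin h l) (tjoin h r)
  | _, _ => Leaf false
  end.

Fixpoint tmeet t u : bool :=
  match t, u with
  | Leaf b, Leaf c => if b then c else false
  | Node l r, Node l' r' => if tmeet l l' then true else tmeet r r'
  | _, _ => false
  end.

Lemma tmem_left t p : tmem (tleft t) p -> tmem t (false :: p).
Proof. by case: t p => [b|l r] []. Qed.

Lemma tmem_right t p : tmem (tright t) p -> tmem t (true :: p).
Proof. by case: t p => [b|l r] []. Qed.

(** Membership is bounded from above only: paths recorded in [I] or [E] must be justified, while a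
    missing one merely stays undecided and weakens [bound]. *)
Lemma tmem_union t u p : tmem (tunion t u) p -> tmem t p || tmem u p.
Proof.
elim: t u p => [[]|l IHl r IHr] u p.
- by move=> /= ->.
- by rewrite /= => ->; rewrite orbT.
case: u => [c|l' r'] /=; first by move->.
by case: p => // -[] p; [exact: IHr | exact: IHl].
Qed.

Lemma tmem_single h p : tmem (tsingle h) p -> p = h.
Proof.
elim: h p => [|b h IH] [|c p] //=; first by case: b.
by case: b; case: c => /=; [move/IH-> | case: p | case: p | move/IH->].
Qed.

Lemma tmem_trie_of L p : tmem (trie_of L) p -> p \in L.
Proof.
elim: L => [|q L IH] /=; first by case: p.
by move/tmem_union/orP => [/tmem_single ->|/IH]; rewrite inE ?eqxx // orbC => ->.
Qed.

Lemma tmem_join h t p : tmem (tjoin h t) p -> exists2 q, tmem t q & p = por h q.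
Proof.
elim: h t p => [|b h IH] [c|l r] [|d p] //=; do ?by case: b.
  by exists [::].
case: b d => [] [] /=; first 1 last.
- by case: p.
- by move/IH => [q tq ->]; exists (true :: q).
- by move/IH => [q tq ->]; exists (false :: q).
move/IH => [q /tmem_union/orP[] tq ->]; [by exists (false :: q)|by exists (true :: q)].
Qed.

Lemma tmeetP t u : tmeet t u -> exists2 p, tmem t p & tmem u p.
Proof.
elim: t u => [b|l IHl r IHr] [c|l' r'] //=; first by case: b c => [] [] //; exists [::].
case: ifP => [/IHl[p tp up] _|_ /IHr[p tp up]]; first by exists (false :: p).
by exists (true :: p).
Qed.

(** Contribution of the set [p] to [sum_i c_i (2 |B_i| - |B|)]. *)
Fixpoint weight (c : seq Z) p : Z :=
  match c, p with
  | x :: c, b :: p => ((if b then x else - x) + weight c p)%Z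
  | _, _ => 0%Z
  end.

(** Least total weight of a family that contains [I] and avoids [E], with closure under unions
    dropped: an undecided path counts only if its weight is negative. [a] carries the weight of the
    prefix read so far. *)
Fixpoint bound (c : seq Z) (a : Z) (I E : trie) : Z :=
  if c is x :: c then
    (bound c (a - x) (tleft I) (tleft E) + bound c (a + x) (tright I) (tright E))%Z
  else if tmem I [::] then a else if tmem E [::] then 0%Z else Z.min 0 a.

Lemma bound_le c a I E (X : pred (seq bool)) :
    (forall p, tmem I p -> X p) -> (forall p, tmem E p -> ~~ X p) ->
  (bound c a I E <=
   (\sum_(p <- cube (size c)) if X p then (a + weight c p)%Z else 0%Z)%R)%Z.
Proof.
elim: c a I E X => [|x c IH] a I E X IX EX /=.
  rewrite big_seq1 Z.add_0_r; case: ifP => [/IX ->|_]; first by lia.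
  case: ifP => [/EX/negbTE ->|_]; first by lia.
  by case: (X [::]); lia.
have hl := IH (a - x)%Z (tleft I) (tleft E) (fun p => X (false :: p))
  (fun p tp => IX _ (tmem_left tp)) (fun p tp => EX _ (tmem_left tp)).
have hr := IH (a + x)%Z (tright I) (tright E) (fun p => X (true :: p))
  (fun p tp => IX _ (tmem_right tp)) (fun p tp => EX _ (tmem_right tp)).
rewrite big_cat !big_map /=.
apply: Z.le_trans (Z.add_le_mono _ _ _ _ hl hr) _; apply: Z.eq_le_incl.
by congr Z.add; apply: eq_bigr => p _; case: (X _) => //; lia.
Qed.

(* [I] and [E] are the paths already decided to be in, resp. out of, the family;
   [ks] lists the paths to branch on. Conditionals are used instead of [&&] and
   [||], whose arguments are both evaluated by [vm_compute]. *)
Fixpoint search (A : trie) (c : seq Z) (ks : seq (seq bool)) (I E : trie) : bool :=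
  if (0 <=? bound c 0 I E)%Z then true else
  if ks is h :: ks then
    if tmem I h then search A c ks I E else
    if (let J := tunion I (tjoin h (tunion I A)) in
        if tmeet J E then true else search A c ks J E)
    then search A c ks I (tunion E (tsingle h)) else false
  else false.

(** If [h] is in [X], so are its unions with all of [I] and [A], and the branch is void when one of
    them is in [E]. If [h] is not in [X], it joins [E]. A branch ends once [bound] is
    nonnegative. *)
Lemma searchP A c ks I E (X : pred (seq bool)) :
    (forall p q, X p -> X q -> X (por p q)) ->
    (forall p q, X p -> tmem A q -> X (por p q)) ->
    (forall p, tmem I p -> X p) -> (forall p, tmem E p -> ~~ X p) ->
    search A c ks I E ->
  (0 <= (\sum_(p <- cube (size c) | X p) weight c p)%R)%Z.
Proof.
move=> Xor XA; elim: ks I E => [|h ks IH] I E IX EX /=.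
  case: ifP => // /Z.leb_le h0 _; apply: Z.le_trans h0 _.
  by rewrite big_mkcond; exact: bound_le.
case: ifP => [/Z.leb_le h0 _|_].
  by apply: Z.le_trans h0 _; rewrite big_mkcond; exact: bound_le.
case: ifP => _; first exact: IH.
case: ifP => // hin hout; case: (boolP (X h)) => Xh.
  have JX p : tmem (tunion I (tjoin h (tunion I A))) p -> X p.
    case/tmem_union/orP => [/IX //|/tmem_join[q /tmem_union/orP[/IX|] Xq ->]].
      exact: Xor.
    exact: XA.
  move: hin => /=; case: ifP => [/tmeetP[p /JX Xp /EX /negP //]|_].
  exact: IH.
apply: IH hout => // p /tmem_union/orP[/EX //|/tmem_single ->//].
Qed.

(* Paths of nonnegative weight are never branched on: [bound] already counts a
   free path of nonnegative weight as absent. *)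
Definition branching_order (c : seq Z) : seq (seq bool) :=
  [seq p <- sort (fun p q => weight c p <=? weight c q)%Z (cube (size c))
     | (weight c p <? 0)%Z].

Definition joins (L : seq (seq bool)) := [seq por p q | p <- L, q <- L].

(** * Weights and FC-families *)

Lemma addZE (x y : Z) : (x + y)%R = (x + y)%Z. Proof. by []. Qed.
Lemma mulZE (x y : Z) : (x * y)%R = (x * y)%Z. Proof. by []. Qed.

Definition sign_of (b : bool) : Z := if b then 1%Z else (-1)%Z.

Lemma sum_sign_star F i :
  (\sum_(A <- F) sign_of (i \in A))%R =
    (2 * Z.of_nat #|` star F i| - Z.of_nat #|` F|)%Z.
Proof.
have -> : #|` star F i| = count (fun A => i \in A) F.
  rewrite -size_filter; apply/perm_size/uniq_perm; rewrite ?filter_uniq //.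
  by move=> A; rewrite mem_filter !inE andbC.
elim: (enum_fset F) => [|A s IH]; first by rewrite big_nil.
rewrite big_cons IH addZE -cat1s count_cat size_cat [count _ [:: _]]/= [size [:: _]]/=.
by rewrite /sign_of; case: (i \in A); lia.
Qed.

Lemma sum_weight_lt0 G (c : seq Z) :
    all (fun x => 0 <? x)%Z c -> c != [::] ->
    (forall i, i \in interval1 (size c) -> 2 * #|` star G i| < #|` G|) ->
  ((\sum_(A <- G) weight c (path_of (size c) A))%R < 0)%Z.
Proof.
move=> c0 cn small.
(* Each excess is a negative integer, hence at most -1, so the sum is at most minus the total of
   [c]. The start [k] is generalised for the induction on [c]. *)
suff H k : (forall i, i \in iota k (size c) -> 2 * #|` star G i| < #|` G|) ->
    ((\sum_(A <- G) weight c [seq i \in A | i <- iota k (size c)])%R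
       <= - foldr Z.add 0 c)%Z.
  apply: Z.le_lt_trans (H 1 _) _; first by move=> i ic; apply: small; rewrite inE.
  suff: (0 < foldr Z.add 0 c)%Z by lia.
  case: c c0 cn {small H} => //= x c /andP[x0 c0] _.
  suff: (0 <= foldr Z.add 0 c)%Z by lia.
  by elim: c c0 => //= y c IH /andP[y0 c0]; have := IH c0; lia.
elim: c k c0 {cn small} => [|x c IH] k /=; first by rewrite big1.
case/andP=> x0 /IH {}IH small.
rewrite big_split /=; have -> : (\sum_(A <- G) (if k \in A then x else - x)%Z)%R =
    (x * \sum_(A <- G) sign_of (k \in A))%R.
  rewrite GRing.mulr_sumr; apply: eq_bigr => A _.
  by case: (k \in A); rewrite /sign_of; lia.
rewrite sum_sign_star addZE mulZE.
have := IH k.+1 (fun i ik => small i (mem_behead (s := k :: _) ik)).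
have := small k (mem_head _ _).
set s := #|` star G k|; set g := #|` G|; move=> lt.
set S' := bigop _ _ _.
have : (2 * Z.of_nat s - Z.of_nat g <= -1)%Z by lia.
nia.
Qed.

Lemma weight_slice_ge0 A (c : seq Z) G Y :
    union_closed G -> pfam A `<=` G -> uniform (size c) A ->
    [disjoint Y & interval1 (size c)] ->
    search (trie_of A) c (branching_order c) (Leaf false) (Leaf false) ->
  (0 <= (\sum_(B <- G | B `\` interval1 (size c) == Y) weight c (path_of (size c) B))%R)%Z.
Proof.
move=> [_ ucG] AG uA dY sAc.
(* [X] is the slice of [G] with trace [Y], restricted to [n]. It is closed under unions since [Y]
   united with itself is [Y], and stable under [A] since members of [A] have empty trace outside
   [n]. *)
pose X p := (size p == size c) && (pset p `|` Y \in G).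
have -> : (\sum_(B <- G | B `\` interval1 (size c) == Y) weight c (path_of (size c) B))%R =
    (\sum_(p <- cube (size c) | X p) weight c p)%R.
  rewrite -big_filter.
  rewrite (perm_big [seq pset p `|` Y | p <- cube (size c) & X p]) /=.
    rewrite big_map big_filter; apply: eq_bigr => p /andP[/eqP sp _].
    by rewrite path_of_pset.
  apply: uniq_perm.
  - by apply: filter_uniq; exact: fset_uniq.
  - rewrite map_inj_in_uniq ?filter_uniq ?cube_uniq //.
    move=> p q; rewrite !mem_filter => /andP[/andP[/eqP sp _] _].
    move=> /andP[/andP[/eqP sq _] _] E.
    by rewrite -(path_of_pset sp dY) E path_of_pset.
  - move=> B; rewrite mem_filter; apply/andP/mapP => [[/eqP BY BG]|[p]].
      exists (path_of (size c) B);
        rewrite ?mem_filter ?mem_cube /X ?pset_path_of -?BY ?fsetID //.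
      by rewrite size_path_of eqxx BG.
    by rewrite mem_filter => /andP[/andP[/eqP sp pG] _] ->; rewrite psetUD.
apply: searchP sAc => [p q|p q|p|p]; rewrite ?/X.
- move=> /andP[/eqP sp pG] /andP[/eqP sq qG].
  rewrite (size_por sp sq) eqxx psetU ?sp //=.
  by rewrite -[Y]fsetUid fsetUACA ucG.
- move=> /andP[/eqP sp pG] /tmem_trie_of qA.
  have /eqP sq := allP uA _ qA.
  rewrite (size_por sp sq) eqxx psetU ?sp //= fsetUAC ucG //.
  by apply: (fsubsetP AG); apply/pfamP; exists q.
- by case: p.
- by case: p.
Qed.

Lemma sum_weight_ge0 A (c : seq Z) G :
    union_closed G -> pfam A `<=` G -> uniform (size c) A ->
    search (trie_of A) c (branching_order c) (Leaf false) (Leaf false) ->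
  (0 <= (\sum_(B <- G) weight c (path_of (size c) B))%R)%Z.
Proof.
move=> ucG AG uA sAc.
rewrite (partition_big_imfset _ (fun B => B `\` interval1 (size c))) /= big_seq.
elim/big_ind: _ => [|x y x0 y0|Y /imfsetP[B /= _ ->]].
- exact: Z.le_refl.
- by rewrite addZE; lia.
apply: weight_slice_ge0 sAc => //.
by apply/fdisjointP => i; rewrite inE => /andP[].
Qed.

Lemma not_non_FC A (c : seq Z) F :
    all (fun x => 0 <? x)%Z c -> c != [::] -> uniform (size c) A ->
    search (trie_of A) c (branching_order c) (Leaf false) (Leaf false) ->
    pfam A `<=` F -> interval1 (size c) `<=` union_of F ->
  ~ non_FC F.
Proof.
move=> c0 cn uA sAc AF UF [_ [G [ucG FG small]]].
apply: (proj1 (Z.le_ngt _ _) (sum_weight_ge0 ucG (fsubset_trans AF FG) uA sAc)).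
apply: sum_weight_lt0 => // i iU.
by apply: small; apply: (fsubsetP UF).
Qed.

(** * Blowing up a family that admits no weights *)

Definition subp p q : bool := por p q == q.

(* The family B_k of the introduction. *)
Definition avoid (L : seq (seq bool)) (k : nat) p : bool :=
  nth false p k.-1 ==> has (fun a => nth false a k.-1 && subp a p) L.

Lemma subpP n p q : size p = n -> size q = n ->
  reflect (forall i, nth false p i -> nth false q i) (subp p q).
Proof.
move=> sp sq; apply: (iffP eqP) => [<- i pi|pq].
  by rewrite nth_por ?sp // pi.
apply: (@eq_from_nth _ false) => [|i _]; first by rewrite (size_por sp sq) sq.
by rewrite nth_por ?sp //; case: (boolP (nth false p i)) => // /pq ->.
Qed.

(** If [k] is in the union, it comes from [p] or [q], and the member of [L] witnessing it there lies
    below the union too. *)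
Lemma avoid_por n L k p q : uniform n L -> size p = n -> size q = n ->
  avoid L k p -> avoid L k q -> avoid L k (por p q).
Proof.
move=> /allP uL sp sq /implyP Lp /implyP Lq; apply/implyP.
have sup r : size r = n -> (forall i, nth false r i -> nth false (por p q) i) ->
    has (fun a => nth false a k.-1 && subp a r) L ->
    has (fun a => nth false a k.-1 && subp a (por p q)) L.
  move=> sr rpq /hasP[a aL /andP[ak ar]]; apply/hasP; exists a; rewrite ?ak //=.
  have sa := eqP (uL _ aL); apply/(subpP sa (size_por sp sq)) => i ai.
  by apply: rpq; apply: (subpP sa sr ar).
rewrite nth_por ?sp // => /orP[/Lp|/Lq]; apply: sup => // i ri.
  by rewrite nth_por ?sp // ri.
by rewrite nth_por ?sp // ri orbT.
Qed.

Lemma avoid_mem n L k p : uniform n L -> p \in L -> avoid L k p.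
Proof.
move=> /allP uL pL; apply/implyP => pk; apply/hasP; exists p; rewrite ?pk //=.
by apply/(subpP (eqP (uL _ pL)) (eqP (uL _ pL))).
Qed.

Section Blowup.
Variables (n : nat) (L : seq (seq bool)) (ks : seq nat).
Let N := size ks.

(* For [0 < j <= N], the set [n+1, n+N] without its [j]-th element; the index
   [N.+1] stands for [n+1, n+N] itself. *)
Definition tail j : {fset nat} :=
  if j == 0 then fset0 else [fset i in iota n.+1 N | i != (n + j)%nat].

(* [nth] defaults to [n.+1] at [j = N.+1], where [avoid] excludes nothing. *)
Definition slice j p : bool :=
  if j == 0 then p \in L else avoid L (nth n.+1 ks j.-1) p.

Definition blowup_seq : seq {fset nat} :=
  [seq pset p `|` tail j | j <- iota 0 N.+2, p <- filter (slice j) (cube n)].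

Definition blowup : set_family := [fset A in blowup_seq].

Lemma blowupP A : reflect
  (exists j p, [/\ j < N.+2, size p = n, slice j p & A = pset p `|` tail j])
  (A \in blowup).
Proof.
have mem_pairs := @allpairsPdep nat (fun=> seq bool) _ (fun j p => pset p `|` tail j).
rewrite in_fset; apply: (iffP (mem_pairs _ _ A)) => [[j [p [jN]]]|].
  rewrite mem_filter mem_cube => /andP[pj /eqP sp] ->.
  by exists j, p; split=> //; rewrite mem_iota in jN.
move=> [j [p [jN sp pj ->]]].
by exists j, p; rewrite mem_filter mem_cube sp mem_iota pj eqxx.
Qed.

Lemma tail_disjoint j : [disjoint tail j & interval1 n].
Proof.
apply/fdisjointP => i; rewrite /tail; case: eqP => // _.
rewrite !inE /= !mem_iota; lia.
Qed.

Lemma tailU j l : j != 0 -> l != 0 -> j != l -> tail j `|` tail l = tail N.+1.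
Proof.
rewrite /tail => /negbTE -> /negbTE -> jl /=; apply/fsetP => i.
rewrite !inE /= !mem_iota; lia.
Qed.

(** For [N = 1] the set [tail 1] would be empty, like [tail 0]. *)
Lemma tail_inj : 1 < N -> {in iota 0 N.+2 &, injective tail}.
Proof.
move=> N1 j l; rewrite !mem_iota => jN lN /fsetP E; apply/eqP/negPn/negP => jl.
(* Every tail of nonzero index contains [n+1] or [n+2]; two tails of distinct nonzero indices differ
   at [n+j] or [n+l]. *)
have := E n.+1; have := E n.+2; have := E (n + j)%nat; have := E (n + l)%nat.
rewrite /tail; case: (j =P 0) => j0; case: (l =P 0) => l0.
all: rewrite !inE /= ?mem_iota; lia.
Qed.

(** Within one slice, closure is that of [L] or of B_k. A union with slice 0 stays in the other
    slice because [L] is contained in every B_k. Two distinct nonzero slices land in slice [N.+1],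
    which holds all subsets of [n]. *)
Lemma union_closed_blowup :
  L != [::] -> uniform n L -> por_closed L -> union_closed blowup.
Proof.
move=> L0 uL cL; split.
  have /hasP[p pL _] : has predT L by rewrite has_predT; case: L L0.
  apply/fset0Pn; exists (pset p `|` tail 0); apply/blowupP.
  by exists 0, p; split=> //; exact/eqP/(allP uL).
have sliceE j p : j != 0 -> slice j p = avoid L (nth n.+1 ks j.-1) p.
  by rewrite /slice => /negbTE ->.
have full p : size p = n -> slice N.+1 p.
  by move=> sp; rewrite sliceE // /avoid !nth_default ?sp.
have base j p : p \in L -> j != 0 -> slice j p.
  by move=> pL j0; rewrite sliceE //; apply: avoid_mem uL pL.
move=> A B /blowupP[j [p [jN sp pj ->]]] /blowupP[l [q [lN sq ql ->]]].
rewrite fsetUACA -psetU ?sp //; apply/blowupP.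
have spq := size_por sp sq.
have [jl|jl] := eqVneq j l.
  subst l; exists j, (por p q); rewrite fsetUid; split => //.
  move: pj ql; rewrite /slice; case: eqP => _; last exact: (avoid_por uL sp sq).
  by move=> pL qL; have /allP/(_ _ qL) := allP cL _ pL.
have [j0|j0] := eqVneq j 0.
  exists l, (por p q); rewrite j0 fset0U; split=> //.
  have l0 : l != 0 by rewrite -j0 eq_sym.
  move: pj ql; rewrite j0 {1}/slice /= !(sliceE _ _ l0) => pL.
  exact: (avoid_por uL sp sq) (avoid_mem _ uL pL).
have [l0|l0] := eqVneq l 0.
  exists j, (por p q); rewrite l0 fsetU0; split=> //.
  move: pj ql; rewrite l0 {2}/slice /= !(sliceE _ _ j0) => pj qL.
  exact: (avoid_por uL sp sq) pj (avoid_mem _ uL qL).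
by exists N.+1, (por p q); rewrite tailU //; split=> //; apply: full.
Qed.

(** The excess [2 |G_i| - |G|] of [blowup], phrased on paths alone so that it can be evaluated by
    [vm_compute]. *)
Definition blowup_excess i : Z :=
  foldr Z.add 0%Z
    [seq sign_of (nth false p i.-1) | j <- iota 0 N.+2, p <- filter (slice j) (cube n)].

Lemma sum_sign_blowup i : 1 < N -> i \in interval1 n ->
  (\sum_(A <- blowup) sign_of (i \in A))%R = blowup_excess i.
Proof.
move=> N1 iU; have [i0 ltin] : 0 < i /\ i.-1 < n.
  by move: iU; rewrite inE /= mem_iota; lia.
(* The trace of a set outside [n] determines [j] and its trace on [n] determines [p], so the
   enumeration lists each set once. *)
have us : uniq blowup_seq.
  apply: allpairs_uniq_dep => [|j _|].
  - exact: iota_uniq.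
  - by apply: filter_uniq; exact: cube_uniq.
  move=> _ _ /allpairsPdep[j [p [jN pj ->]]] /allpairsPdep[l [q [lN ql ->]]] /= E.
  move: pj ql; rewrite !mem_filter !mem_cube => /andP[_ /eqP sp] /andP[_ /eqP sq].
  have jl : j = l.
    apply: tail_inj => //.
    by rewrite -(psetUD sp (tail_disjoint j)) E (psetUD sq (tail_disjoint l)).
  subst l; congr Tagged.
  by rewrite -(path_of_pset sp (tail_disjoint j)) E (path_of_pset sq (tail_disjoint j)).
have -> : (\sum_(A <- blowup) sign_of (i \in A))%R =
    (\sum_(A <- blowup_seq) sign_of (i \in A))%R.
  apply: perm_big; apply: uniq_perm => [||A]; first exact: fset_uniq.
    exact: us.
  exact: in_fset.
rewrite /blowup_excess -[foldr _ _ _]/(foldr (@GRing.add Z) 0%R _) foldrE !big_allpairs_dep.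
apply: eq_bigr => j _; rewrite big_seq [RHS]big_seq; apply: eq_bigr => p.
rewrite mem_filter mem_cube => /andP[_ /eqP sp].
rewrite inE in_pset i0 /=; suff -> : i \in tail j = false by rewrite orbF.
by apply/negbTE; apply/negP => /(fdisjointP (tail_disjoint j)); rewrite iU.
Qed.

Lemma non_FC_blowup F : L != [::] -> uniform n L -> por_closed L -> 1 < N ->
  union_closed F -> F `<=` pfam L -> all (fun i => blowup_excess i <? 0)%Z (iota 1 n) ->
  non_FC F.
Proof.
move=> L0 uL cL N1 ucF FL /allP neg; split=> //; exists blowup; split.
- exact: union_closed_blowup.
- apply/fsubsetP => A /(fsubsetP FL)/pfamP[p pL ->]; apply/blowupP.
  exists 0, p; rewrite fsetU0; split=> //; exact/eqP/(allP uL).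
move=> i /bigfcupP[A /andP[/(fsubsetP FL)/pfamP[p pL ->] _] ip].
have iU : i \in iota 1 n.
  move: ip; rewrite in_pset mem_iota; case: i => //= i pi.
  rewrite add1n ltnS ltnNge; apply: contraL pi => ni.
  by rewrite nth_default ?(eqP (allP uL _ pL)).
have := neg i iU; rewrite -sum_sign_blowup //; last by rewrite inE.
rewrite sum_sign_star; lia.
Qed.

End Blowup.

(** * The counterexample *)

Lemma uc_gen_sub S G : union_closed G -> S `<=` G -> uc_gen S `<=` G.
Proof.
move=> ucG SG; rewrite /uc_gen; case: classical_sets.xgetP => [F _ [_ _ minF]|_].
  exact: minF.
exact: fsub0set.
Qed.

(** A proper subfamily [T] misses some [A], so what it generates stays inside [G] and does not
    contain [A], whereas [uc_gen S] does. *)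
Lemma minimal_generatorP S : S != fset0 ->
    (forall A, A \in S -> exists G, [/\ union_closed G, S `\ A `<=` G & A \notin G]) ->
  minimal_generator S (uc_gen S).
Proof.
move=> S0 irr; split=> // T TS eqTS.
have [A AS AT] : exists2 A, A \in S & A \notin T.
  by move: TS; rewrite fproperE => /andP[_ /fsubsetPn].
have [G [ucG SG]] := irr A AS; apply/negP/negPn.
have : A \in uc_gen S by case: (uc_genP S0) => _ /fsubsetP/(_ _ AS).
rewrite -eqTS; apply: fsubsetP; apply: uc_gen_sub ucG _.
by apply: fsubset_trans SG; rewrite fsubsetD1 AT fproper_sub.
Qed.

(** * Explicit generators, multiplicities and weights, and their checks by computation *)

Definition path_seq n (s : seq nat) : seq bool := [seq i \in s | i <- iota 1 n].

Lemma pset_path_seq n (s : seq nat) : all (fun i => 0 < i <= n) s ->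
  pset (path_seq n s) = [fset i in s].
Proof.
move=> /allP sn; apply/fsetP => i; rewrite in_pset in_fset /path_seq.
case: (boolP (i.-1 < n)) => ltin.
  rewrite (nth_map 0) ?size_iota // nth_iota // add1n.
  by case: i ltin => [|i] //= _; apply/esym/negbTE/negP => /sn.
rewrite nth_default ?size_map ?size_iota 1?leqNgt // andbF; apply/esym/negbTE/negP => /sn.
lia.
Qed.

(** The five-element case has the shape of [A] united with a singleton, as produced by [regular]. *)
Lemma fset_seqE :
  (([fset i in [::]] = fset0 :> {fset nat}) *
   (forall a b c, [fset i in [:: a; b; c]] = [fset a; b; c] :> {fset nat}) *
   (forall a b c d, [fset i in [:: a; b; c; d]] = [fset a; b; c; d] :> {fset nat}) *
   (forall a b c d e,
      [fset i in [:: a; b; c; d; e]] = [fset a; b; c; d] `|` [fset e] :> {fset nat}))%type.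
Proof. by do !split=> *; apply/fsetP => i; rewrite !inE /= -?orbA ?orbF. Qed.

Lemma pfam_joins n L F : union_closed F -> uniform n L ->
  pfam L `<=` F -> pfam (joins L) `<=` F.
Proof.
move=> [_ ucF] /allP uL /fsubsetP LF.
apply/fsubsetP => _ /pfamP[_ /allpairsP[[p q] [pL qL ->]] ->].
rewrite psetU ?(eqP (uL _ pL)) ?(eqP (uL _ qL)) //.
by apply: ucF; apply: LF; apply/pfamP; [exists p|exists q].
Qed.

Definition paths := map (path_seq 6).

Definition gens := paths
  [:: [::]; [:: 4; 5; 6]; [:: 1; 3; 4]; [:: 1; 2; 5; 6]; [:: 1; 2; 3; 4]].

Definition enlarged_gens := paths
  [:: [::]; [:: 4; 5; 6]; [:: 1; 3; 4]; [:: 1; 2; 5; 6]; [:: 1; 2; 3; 4; 5]].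

(** All of <S>: the empty set is a generator, so single generators occur among the joins, and for
    these generators pairwise unions are already closed under union. *)
Definition span := undup (joins gens).

(* Obtained by rounding an optimal mixed strategy of the matrix game whose payoffs
   are the excesses 2 |(B_k)_i| - |B_k|. *)
Definition multiplicities :=
  flatten [:: nseq 40 1; nseq 12 2; nseq 28 3; nseq 59 4; nseq 43 5; nseq 43 6].

Lemma blowup_excess_lt0 :
  all (fun i => blowup_excess 6 span multiplicities i <? 0)%Z (iota 1 6).
Proof. by vm_compute. Qed.

(* Obtained by scaling and rounding a solution of the linear program whose
   constraints are the families violating the previous candidate weights. *)
Definition fc_weights : seq Z := [:: 16; 8; 12; 20; 17; 15]%Z.

Lemma search_enlarged : search (trie_of (joins enlarged_gens)) fc_weights
  (branching_order fc_weights) (Leaf false) (Leaf false).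
Proof. by vm_compute. Qed.

Lemma gens_span : {subset gens <= span}.
Proof. by apply/allP; vm_compute. Qed.

(** No generator is a union of other members of [span], so deleting it leaves a union-closed family,
    the [G] required by [minimal_generatorP]. *)
Lemma gens_irredundant p : p \in gens ->
  [/\ union_closed (pfam (rem p span)),
      pfam gens `\ pset p `<=` pfam (rem p span) & pset p \notin pfam (rem p span)].
Proof.
have us : uniform 6 span by vm_compute.
have gs := gens_span.
have /allP irr : all (fun p => por_closed (rem p span)) gens by vm_compute.
have /allP non0 : all (fun p => rem p span != [::]) gens by vm_compute.
move=> pg; have usp : uniform 6 (rem p span).
  by apply/allP => q /mem_rem; apply: (allP us).
have rem_pE q : (q \in rem p span) = (q != p) && (q \in span).
  by rewrite mem_rem_uniq ?undup_uniq // inE.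
split.
- exact: union_closed_pfam (non0 _ pg) usp (irr _ pg).
- apply/fsubsetP => A; rewrite in_fsetD1 => /andP[Ap /pfamP[q qg Aq]].
  apply/pfamP; exists q => //; rewrite rem_pE gs // andbT.
  by apply: contra_neq Ap; rewrite Aq => ->.
- apply/pfamP => -[q qs /(@pset_inj 6) E].
  move: (qs); rewrite rem_pE -E ?eqxx //; rewrite inE; apply: (allP us).
    exact: gs.
  exact: mem_rem qs.
Qed.

Theorem corollary4 :
  let S : set_family :=
    [fset fset0; [fset 4; 5; 6]; [fset 1; 3; 4]; [fset 1; 2; 5; 6];
          [fset 1; 2; 3; 4]] in
  [/\ union_of S = interval1 6,
      minimal_generator S (uc_gen S),
      non_FC (uc_gen S)
    & ~ regular 6 S].
Proof.
move=> S.
have SE : S = pfam gens.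
  apply/fsetP => A; rewrite /S /pfam /gens /paths -map_comp /= !pset_path_seq //.
  by rewrite !fset_seqE !inE -!orbA orbF.
have S0 : S != fset0 by apply/fset0Pn; exists fset0; rewrite !inE.
have [ucS SgenS _] := uc_genP S0.
split.
- rewrite /S !union_ofU !union_of1; apply/fsetP => i.
  by rewrite [RHS]in_fset [RHS]mem_iota !inE; lia.
- apply: minimal_generatorP => // A; rewrite SE => /pfamP[p pg ->].
  by exists (pfam (rem p span)); apply: gens_irredundant.
- have us : uniform 6 span by vm_compute.
  have cs : por_closed span by vm_compute.
  have n0 : span != [::] by vm_compute.
  have le1 : 1 < size multiplicities by [].
  apply: (@non_FC_blowup 6 span multiplicities (uc_gen S) n0 us cs le1 ucS _ blowup_excess_lt0).
  apply: uc_gen_sub; first exact: union_closed_pfam n0 us cs.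
  rewrite SE; apply/fsubsetP => A /pfamP[p pg ->]; apply/pfamP.
  by exists p; first exact: gens_span.
(* Regularity is refuted at [A = {1,2,3,4}] and [i = 5], which turns [S] into the family of
   [enlarged_gens]. *)
have BS : [fset 1; 2; 3; 4] \in S by rewrite !inE eqxx !orbT.
have B0 : [fset 1; 2; 3; 4] != fset0 :> {fset nat}.
  by apply/fset0Pn; exists 1; rewrite !inE.
have U5 : 5 \in interval1 6 by rewrite in_fset.
move=> /(_ _ BS B0 5 U5).
set T := _ `|` _; have T0 : T != fset0.
  by apply/fset0Pn; exists ([fset 1; 2; 3; 4] `|` [fset 5]); rewrite !inE eqxx orbT.
have [ucT /fsubsetP TgenT _] := uc_genP T0.
(* A member of [S] that differs from {1,2,3,4} at a point [i] survives the replacement. *)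
have old A i : A \in S -> i \in [fset 1; 2; 3; 4] != (i \in A) -> A \in uc_gen T.
  move=> AS iA; apply: TgenT; rewrite in_fsetU in_fsetD1 AS andbT.
  by apply/orP; left; apply: contra_neq iA => ->.
have genT A : A \in [:: fset0; [fset 4; 5; 6]; [fset 1; 3; 4]; [fset 1; 2; 5; 6];
   [fset 1; 2; 3; 4] `|` [fset 5]] -> A \in uc_gen T.
  rewrite !inE => /or4P[/eqP->|/eqP->|/eqP->|/orP[]/eqP->].
  - by apply: (old _ 1); rewrite !inE ?eqxx ?orbT.
  - by apply: (old _ 6); rewrite !inE ?eqxx ?orbT.
  - by apply: (old _ 2); rewrite !inE ?eqxx ?orbT.
  - by apply: (old _ 6); rewrite !inE ?eqxx ?orbT.
  - by apply: TgenT; rewrite !inE eqxx orbT.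
have ue : uniform 6 enlarged_gens by [].
have uj : uniform 6 (joins enlarged_gens) by vm_compute.
have cpos : all (fun x => 0 <? x)%Z fc_weights by [].
apply: (@not_non_FC (joins enlarged_gens) fc_weights (uc_gen T) cpos isT uj search_enlarged).
  apply: pfam_joins ucT ue _; apply/fsubsetP => A.
  rewrite /pfam /enlarged_gens /paths -map_comp /= !pset_path_seq // !fset_seqE.
  by rewrite !inE orbF => AT; apply: genT; rewrite !inE.
apply/fsubsetP => i iU; apply/bigfcupP.
have {iU} iU : 1 <= i < 7 by move: iU; rewrite in_fset [_ \in _]mem_iota.
have [->|i6] := eqVneq i 6.
  by exists [fset 4; 5; 6]; rewrite ?genT // !inE ?eqxx ?orbT.
exists ([fset 1; 2; 3; 4] `|` [fset 5]); first by rewrite genT // !inE eqxx !orbT.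
by rewrite !inE; lia.
Qed.
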